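(* For all integers $k \geq 3$ and $m \geq k+1$, there exists a $2$-edge-colouring (with colours red and blue) of the complete $k$-graph $K_{k(m+1)+1}^{(k)}$ that does not admit a partition of its vertex set into two (vertex sets of) monochromatic tight cycles of distinct colours, i.e. one red tight cycle and one blue tight cycle, where degenerate cycles are allowed.
   Context: A $k$-graph $H$ is a pair $(V(H),E(H))$ with $E(H)\subseteq \binom{V(H)}{k}$; $K_n^{(k)}$ is the complete $k$-graph on $n$ vertices. For $n>k$, a ($k$-uniform) tight cycle on $n$ vertices is a $k$-graph whose vertices can be ordered as $v_0,\dots,v_{n-1}$ so that its edges are exactly the sets $\{v_i,v_{i+1},\dots,v_{i+k-1}\}$, $0\le i\le n-1$, indices modulo $n$. In addition, a single edge, or any set of fewer than $k$ vertices (including the empty set), is considered a (degenerate) tight cycle. A tight cycle in an edge-coloured $k$-graph is red (blue) if all its edges are red (blue); a degenerate cycle with fewer than $k$ vertices has no edges and may be regarded as having either colour. *)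

(* Defs.v *)
From mathcomp Require Import all_boot.
Set Implicit Arguments.
Unset Strict Implicit.
Unset Printing Implicit Defensive.

Record kgraph (k : nat) (T : finType) := KGraph {
  vset : {set T};
  eset : {set {set T}};
  kgraphP : forall e, e \in eset -> e \subset vset /\ #|e| = k
}.

Definition subgraph (k : nat) (T : finType) (C H : kgraph k T) : Prop :=
  vset C \subset vset H /\ eset C \subset eset H.

Lemma complete_kgraphP (k : nat) (T : finType) (e : {set T}) :
  e \in [set e : {set T} | #|e| == k] -> e \subset [set: T] /\ #|e| = k.
Proof. by rewrite inE subsetT => /eqP. Qed.

Definition complete_kgraph (k : nat) (T : finType) : kgraph k T :=
  KGraph (@complete_kgraphP k T).

(* The set {v_i, v_{i+1}, ..., v_{i+k-1}}, indices modulo n. *)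
Definition window (k : nat) (T : finType) (n : nat) (v : 'I_n -> T) (i : 'I_n)
    : {set T} :=
  [set v j | j : 'I_n & [exists l : 'I_k, nat_of_ord j == (i + l) %% n]].

Definition proper_tight_cycle (k : nat) (T : finType) (C : kgraph k T) : Prop :=
  exists (n : nat) (v : 'I_n -> T),
    [/\ k < n, injective v, vset C = [set v i | i : 'I_n]
      & eset C = [set window k v i | i : 'I_n]].

(* The degenerate cycles: a single edge, or fewer than k vertices (possibly
   none). *)
Definition degenerate_tight_cycle (k : nat) (T : finType) (C : kgraph k T)
    : Prop :=
  (#|vset C| = k /\ eset C = [set vset C])
  \/ (#|vset C| < k /\ eset C = set0).

Definition tight_cycle (k : nat) (T : finType) (C : kgraph k T) : Prop :=
  proper_tight_cycle C \/ degenerate_tight_cycle C.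

Inductive colour := Red | Blue.

Definition edge_colouring (k : nat) (T : finType) (H : kgraph k T) : Type :=
  {e : {set T} | e \in eset H} -> colour.

(* A cycle without edges has both colours. *)
Definition tight_cycle_of_colour (k : nat) (T : finType) (H : kgraph k T)
    (c : edge_colouring H) (a : colour) (C : kgraph k T) : Prop :=
  [/\ tight_cycle C, subgraph C H
    & forall e : {e : {set T} | e \in eset H}, val e \in eset C -> c e = a].

Definition red_blue_cycle_partition (k : nat) (T : finType) (H : kgraph k T)
    (c : edge_colouring H) : Prop :=
  exists R B : kgraph k T,
    [/\ tight_cycle_of_colour c Red R, tight_cycle_of_colour c Blue B,
        vset R :|: vset B = vset H & [disjoint vset R & vset B]].

(* Main.v *)
Require Import Defs.
From mathcomp Require Import all_boot zify.

(* Fix a vertex x and a set A of m + 2 other vertices.  An edge avoiding x is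
   red iff it meets A in exactly one vertex; an edge through x is red iff it
   meets A in at least two.  Consecutive edges of a tight cycle have A-counts
   differing by at most one.  So a red cycle on more than k vertices avoids x and
   has exactly one vertex of A in every window, hence k * s vertices, s of them
   in A.  In a blue cycle, either A is missed altogether or each edge avoiding x
   has two vertices in A.  If red has k * s vertices, then blue has k * t + 1
   with s + t = m + 1, and t + 1 of these are in A, so t = 0 or t + 1 >= 2 * t.
   For t = 0 blue is {x}, which misses A.  For t = 1 blue has k + 1 vertices, two
   of them in A, and each blue edge through x omits one of these two, which is
   impossible since k of the k + 1 edges pass through x and k > 2.  If red is
   degenerate, blue needs at least 2 * m > m + 2 vertices of A. *)

Set Implicit Arguments.
Unset Strict Implicit.
Unset Printing Implicit Defensive.

(** * Sums over windows of [k] consecutive terms of a sequence *)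

Section WindowSums.

Variables (k : nat) (a : nat -> nat).

Definition wsum (i : nat) : nat := \sum_(l < k) a (i + l).

Lemma wsumS i : wsum i.+1 + a i = wsum i + a (i + k).
Proof.
rewrite /wsum -(big_ord_recr k (fun l => a (i + l))) big_ord_recl /= addn0 addnC.
by congr (_ + _); apply: eq_bigr => l _; rewrite /bump /= addnA addn1.
Qed.

Lemma sum_blocks d t :
  \sum_(j < k * t) a (d + j) = \sum_(s < t) wsum (d + k * s).
Proof.
elim: t => [|t IH]; first by rewrite muln0 !big_ord0.
rewrite big_ord_recr -IH mulnS addnC big_split_ord /=; congr (_ + _).
by apply: eq_bigr => l _; rewrite addnA.
Qed.

(** Equal sums of neighbouring windows make [a] periodic mod [k]. Combined with period [n], a 1 at
    [i] recurs at [i + n %% k]; unless [n %% k = 0] this is a second 1 in the window at [i]. *)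
Lemma wsum_eq1_period n :
  0 < k -> (forall i, a i <= 1) -> (forall i, a (i + n) = a i) ->
  (forall i, wsum i = 1) -> k %| n /\ \sum_(j < n) a j = n %/ k.
Proof.
move=> k_gt0 a_le1 a_n wsum1.
have a_k i : a (i + k) = a i by have := wsumS i; rewrite !wsum1; lia.
have a_kM i q : a (i + q * k) = a i.
  by elim: q => [|q IH]; rewrite ?addn0 // mulSn addnCA addnC a_k.
have dvd_kn : k %| n.
  have [i ai] : exists i, a i = 1.
    have [/existsP[l /eqP al]|/existsPn al0] :=
      boolP [exists l : 'I_k, a (0 + l) == 1]; first by exists (0 + l).
    have := wsum1 0; rewrite /wsum big1 // => l _.
    by have := al0 l; have := a_le1 (0 + l); case: (a _) => [|[]].
  have aim : a (i + n %% k) = 1.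
    by rewrite -(a_kM _ (n %/ k)) -addnA [n %% k + _]addnC -divn_eq a_n.
  apply/eqP; have [//|r_gt0] := posnP (n %% k).
  have := wsum1 i; rewrite /wsum (bigD1 (Ordinal k_gt0)) //= addn0 ai.
  rewrite (bigD1 (Ordinal (ltn_pmod n k_gt0))) /=; first by rewrite aim; lia.
  by rewrite -val_eqE /= -lt0n.
split=> //; have /(congr1 (fun p => \sum_(j < p) a j)) := divnK dvd_kn.
move=> <-; rewrite mulnC; have := sum_blocks 0 (n %/ k).
under eq_bigr => j _ do rewrite add0n.
by move=> ->; under eq_bigr => s _ do rewrite wsum1; rewrite sum1_card card_ord.
Qed.

(** Meant for index [0] at the vertex [x], so that the constrained windows are those missing [x]. A
    shift by one changes a window sum by at most one, so the sums cannot cross 1: all are 0 or all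
    are at least 2. In the latter case [n.-1 %/ k] disjoint windows are packed after index [0]. *)
Lemma wsum_neq1_split n :
  0 < k -> k < n -> (forall i, a i <= 1) ->
  (forall i, 0 < i -> i + k <= n -> wsum i != 1) ->
  (forall j, 0 < j < n -> a j = 0) \/
  2 * (n.-1 %/ k) <= \sum_(j < n.-1) a j.+1.
Proof.
move=> k_gt0 k_lt_n a_le1 wsumN1.
have spread i : i + k < n ->
    wsum i.+1 = 0 /\ wsum 1 = 0 \/ 1 < wsum i.+1 /\ 1 < wsum 1.
  elim: i => [|i IH] lt_n.
    by have := wsumN1 1 isT; rewrite add1n => /(_ k_lt_n); lia.
  have := wsumS i.+1; have := a_le1 i.+1; have := a_le1 (i.+1 + k).
  have := wsumN1 i.+2 isT lt_n; have := IH (ltnW lt_n); lia.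
have [w0|w_gt1] : wsum 1 = 0 \/ 1 < wsum 1 by have := @spread 0 k_lt_n; lia.
- left=> j /andP[j_gt0 j_lt_n].
  (* An index [j >= k] is the last one of its window; a smaller one lies in the window starting at
     1. *)
  have [i [l [lt_n def_j]]] : exists i (l : 'I_k), i + k < n /\ j = i.+1 + l.
    have [le_kj|lt_jk] := leqP k j.
      have lt_k : k.-1 < k by lia.
      by exists (j - k), (Ordinal lt_k) => /=; lia.
    have lt_k : j.-1 < k by lia.
    by exists 0, (Ordinal lt_k) => /=; lia.
  have [[]|] := spread i lt_n; last by lia.
  by move=> /eqP; rewrite sum_nat_eq0 => /forallP/(_ l)/eqP; rewrite -def_j.
- right; apply: leq_trans (_ : \sum_(j < k * (n.-1 %/ k)) a (1 + j) <= _).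
    rewrite sum_blocks mulnC -[X in X * 2]card_ord -sum_nat_const.
    apply: leq_sum => s _; rewrite add1n.
    have lt_n : k * s + k < n.
      have := leq_divM n.-1 k; have := ltn_ord s; nia.
    by case: (spread _ lt_n) => [][]; lia.
  rewrite -!(big_mkord xpredT (fun j => a j.+1)).
  rewrite [X in _ <= X](@big_cat_nat _ _ _ (k * (n.-1 %/ k))) //=; last first.
    by rewrite mulnC leq_divM.
  exact: leq_addr.
Qed.

End WindowSums.

(** * Tight cycles as periodic sequences *)

Lemma card_setI_imset (T : finType) (A : {set T}) n (g : 'I_n -> T) :
  injective g -> #|A :&: [set g i | i : 'I_n]| = \sum_(i < n) (g i \in A).
Proof.
move=> g_inj.
have -> : A :&: [set g i | i : 'I_n] = [set g i | i in [set i | g i \in A]].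
  apply/setP=> y; rewrite inE; apply/andP/imsetP=> [[yA /imsetP[i _ yE]]|[i]].
    by exists i; rewrite // inE -yE.
  by rewrite inE => giA ->; rewrite giA imset_f.
rewrite card_imset // -sum1_card big_mkcond; apply: eq_bigr => i _.
by rewrite inE; case: (_ \in A).
Qed.

Lemma injective_prefix (T : Type) (u : nat -> T) k n :
  k <= n -> injective (fun l : 'I_n => u l) -> injective (fun l : 'I_k => u l).
Proof.
move=> le_kn u_inj l1 l2 /(u_inj (widen_ord le_kn l1) (widen_ord le_kn l2)).
by move=> /(congr1 val) /= /val_inj.
Qed.

(** Unrolling the cycle along the naturals replaces indices modulo [n] by periodicity, and the free
    offset [d] lets later arguments start the cycle at any vertex. *)
Lemma proper_tight_cycle_periodic k (T : finType) (C : kgraph k T) :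
  proper_tight_cycle C ->
  exists n (w : nat -> T),
    [/\ k < n,
        forall i, w (i + n) = w i,
        forall d, injective (fun l : 'I_n => w (d + l)),
        forall d, vset C = [set w (d + l) | l : 'I_n]
      & forall d, [set w (d + l) | l : 'I_k] \in eset C].
Proof.
move=> [n [v [lt_kn v_inj vsetE esetE]]].
have n_gt0 : 0 < n by lia.
pose w i := v (Ordinal (ltn_pmod i n_gt0)).
have w_inj d : injective (fun l : 'I_n => w (d + l)).
  move=> l1 l2 /v_inj/(congr1 val)/= /eqP; rewrite eqn_modDl !modn_small //.
  by move/eqP/val_inj.
exists n, w; split=> // [i|d|d].
- by congr v; apply: val_inj; rewrite /= modnDr.
- apply/esym/eqP; rewrite eqEcard vsetE !card_imset // leqnn andbT.
  by apply/subsetP=> y /imsetP[l _ ->]; apply: imset_f.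
- rewrite esetE; apply/imsetP; exists (Ordinal (ltn_pmod d n_gt0)) => //.
  apply/setP=> y; apply/imsetP/imsetP=> [[l _ ->]|[j]].
    exists (Ordinal (ltn_pmod (d + l) n_gt0)) => //.
    by rewrite inE; apply/existsP; exists l; rewrite /= modnDml.
  rewrite inE => /existsP[l /eqP jE] ->; exists l => //.
  by congr v; apply: val_inj; rewrite /= jE /= modnDml.
Qed.

(** * The colouring and its monochromatic cycles *)

Section Colouring.

Variables (k : nat) (T : finType) (x : T) (A : {set T}).
Hypotheses (k_gt2 : 2 < k) (xNA : x \notin A).

Definition is_red (e : {set T}) : bool :=
  if x \in e then 1 < #|A :&: e| else #|A :&: e| == 1.

Lemma red_cycle_count (C : kgraph k T) :
  proper_tight_cycle C -> (forall e, e \in eset C -> is_red e) ->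
  x \notin vset C /\ #|vset C| = k * #|A :&: vset C|.
Proof.
move=> /proper_tight_cycle_periodic[n [w [lt_kn w_n w_inj vsetE w_eset]]] red.
pose a i : nat := w i \in A.
have a_le1 i : a i <= 1 by rewrite /a; case: (_ \in _).
have win_inj d : injective (fun l : 'I_k => w (d + l)).
  exact: (injective_prefix (u := fun l => w (d + l)) (ltnW lt_kn)).
have cardW d : #|A :&: [set w (d + l) | l : 'I_k]| = wsum k a d.
  by rewrite card_setI_imset.
have xNC : x \notin vset C.
  apply/negP; rewrite (vsetE 0) => /imsetP[j _ xE]; rewrite add0n in xE.
  have := red _ (w_eset j); have := red _ (w_eset j.+1).
  rewrite /is_red !cardW ifN; last first.
    apply/imsetP=> -[l _]; rewrite xE => wE.
    have lt0n : 0 < n by lia.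
    have ltln : l.+1 < n by have := ltn_ord l; lia.
    have := w_inj j (Ordinal lt0n) (Ordinal ltln).
    by rewrite /= addn0 addnS wE => /(_ erefl).
  rewrite ifT; last first.
    have k_gt0 : 0 < k by lia.
    by apply/imsetP; exists (Ordinal k_gt0); rewrite //= addn0.
  (* The window at [j] contains [x] and needs two vertices of [A], the next one avoids [x] and needs
     exactly one; but the shift drops only [x], which is not in [A]. *)
  have aj0 : a j = 0 by rewrite /a -xE (negbTE xNA).
  by have := wsumS k a j; rewrite aj0; lia.
have wsum1 d : wsum k a d = 1.
  have := red _ (w_eset d); rewrite /is_red cardW ifN => [/eqP//|].
  apply: contra xNC => /imsetP[l _ ->].
  by rewrite (vsetE d) (imset_f _ (x := widen_ord (ltnW lt_kn) l)).
have a_n i : a (i + n) = a i by rewrite /a w_n.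
have [] := wsum_eq1_period (n := n) (k := k) (a := a) _ a_le1 a_n wsum1; first lia.
move=> dvd_kn sumE; split=> //.
rewrite (vsetE 0) card_setI_imset // card_imset // card_ord.
by rewrite (eq_bigr (fun i : 'I_n => a i)) // sumE mulnC divnK.
Qed.

Lemma blue_cycle_count (C : kgraph k T) :
  proper_tight_cycle C -> (forall e, e \in eset C -> ~~ is_red e) ->
  A :&: vset C = set0 \/ 2 * ((#|vset C|).-1 %/ k) <= #|A :&: vset C|.
Proof.
move=> /proper_tight_cycle_periodic[n [w [lt_kn w_n w_inj vsetE w_eset]]] blue.
(* The cycle is rotated to start at [x]; if it misses [x], any start will do. *)
have [j xP] : exists j, x \in vset C -> w j = x.
  have [|_] := boolP (x \in vset C); last by exists 0.
  by rewrite (vsetE 0) => /imsetP[j _ ->]; exists j.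
pose a i : nat := w (j + i) \in A.
have a_le1 i : a i <= 1 by rewrite /a; case: (_ \in _).
have win_inj d : injective (fun l : 'I_k => w (d + l)).
  exact: (injective_prefix (u := fun l => w (d + l)) (ltnW lt_kn)).
have cardW d : #|A :&: [set w (j + d + l) | l : 'I_k]| = wsum k a d.
  by rewrite card_setI_imset //; apply: eq_bigr => l _; rewrite /a addnA.
have wsumN1 d : x \notin [set w (j + d + l) | l : 'I_k] -> wsum k a d != 1.
  by move=> xNW; have := blue _ (w_eset (j + d)); rewrite /is_red cardW ifN.
have cardA : #|A :&: vset C| = \sum_(i < n) a i.
  by rewrite (vsetE j) card_setI_imset.
have n_gt0 : 0 < n by lia.
have cardA' : #|A :&: vset C| = a 0 + \sum_(i < n.-1) a i.+1.
  by rewrite cardA -[in LHS](prednK n_gt0) big_ord_recl.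
have cardC : #|vset C| = n by rewrite (vsetE j) card_imset // card_ord.
have k_gt0 : 0 < k by lia.
have mem_C d (l : 'I_k) : w (j + d + l) \in vset C.
  by rewrite (vsetE (j + d)) (imset_f _ (x := widen_ord (ltnW lt_kn) l)).
case: (wsum_neq1_split k_gt0 lt_kn a_le1).
- move=> i i_gt0 le_n; apply: wsumN1; apply/imsetP=> -[l _ xE].
  have wE : w j = x by apply: xP; rewrite xE.
  have lt_n : i + l < n by have := ltn_ord l; lia.
  have := w_inj j (Ordinal n_gt0) (Ordinal lt_n).
  rewrite /= addn0 addnA wE -xE => /(_ erefl)/(congr1 val) /=; lia.
- move=> a0; left; apply/eqP; rewrite -cards_eq0 cardA'.
  rewrite [X in _ + X]big1 => [|i _]; last by apply: a0; have := ltn_ord i; lia.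
  (* Only index 0 remains: it carries [x], or else its window also avoids [x] and has sum [a 0],
     which therefore is not 1. *)
  rewrite addn0; have [xC|xNC] := boolP (x \in vset C).
    by rewrite /a addn0 xP // (negbTE xNA).
  have : wsum k a 0 != 1.
    by apply: wsumN1; apply: contra xNC => /imsetP[l _ ->].
  rewrite /wsum -(prednK k_gt0) big_ord_recl /= big1 => [|i _].
    by rewrite addn0; have := a_le1 0; case: (a 0) => [|[]].
  by rewrite add0n a0 // /bump /=; have := ltn_ord i; lia.
- by right; rewrite cardC cardA'; lia.
Qed.

(** Every window omits exactly one vertex. If it omits [y] other than [x], it contains [x], so being
    blue it misses one of the two vertices of [A]; hence [y] is in [A]. This puts [k > 2] vertices
    in [A]. *)
Lemma blue_cycle_succ_k (C : kgraph k T) :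
  proper_tight_cycle C -> (forall e, e \in eset C -> ~~ is_red e) ->
  x \in vset C -> #|vset C| = k.+1 -> #|A :&: vset C| != 2.
Proof.
move=> /proper_tight_cycle_periodic[n [w [lt_kn w_n w_inj vsetE w_eset]]] blue.
move=> xC cardC; apply/eqP=> cardA2.
have def_n : n = k.+1 by rewrite -cardC (vsetE 0) card_imset // card_ord.
subst n.
have allA : vset C :\ x \subset A.
  apply/subsetP=> y; rewrite in_setD1 => /andP[y_neq_x].
  rewrite {1}(vsetE 0) => /imsetP[j _ yE]; rewrite add0n in yE.
  have := blue _ (w_eset j.+1).
  have vsetU : vset C = y |: [set w (j.+1 + l) | l : 'I_k].
    apply/setP=> z; rewrite (vsetE j) in_setU1.
    apply/imsetP/idP=> [[l _ ->]|/predU1P[->|/imsetP[l _ ->]]].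
    - have [l' ->|->] := unliftP ord0 l; last by rewrite yE /= addn0 eqxx.
      apply/orP; right; apply/imsetP; exists l' => //.
      by rewrite lift0 addSnnS.
    - by exists ord0; rewrite //= addn0.
    - by exists (lift ord0 l); rewrite // lift0 addSnnS.
  have xW : x \in [set w (j.+1 + l) | l : 'I_k].
    by move: xC; rewrite vsetU in_setU1 eq_sym (negbTE y_neq_x).
  rewrite /is_red xW -leqNgt; apply: contraTT => yNA.
  rewrite -ltnNge -[X in X <= _]cardA2 subset_leq_card //.
  apply/subsetP=> z; rewrite vsetU !inE => /andP[zA /predU1P[zy|->]].
    by rewrite -zy zA in yNA.
  by rewrite zA.
have := cardsD1 x (vset C); rewrite cardC xC => /eqP.
rewrite add1n eqSS => /eqP kE.
suff : k <= 2 by lia.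
by rewrite -cardA2 [X in X <= _]kE subset_leq_card // subsetI allA subD1set.
Qed.

Definition red_blue : edge_colouring (complete_kgraph k T) :=
  fun e => if is_red (val e) then Red else Blue.

Lemma cycle_is_red (C : kgraph k T) :
  tight_cycle_of_colour red_blue Red C -> forall e, e \in eset C -> is_red e.
Proof.
move=> [_ [_ /subsetP sub] col] e eC.
by have := col (exist _ e (sub e eC)) eC; rewrite /red_blue /=; case: is_red.
Qed.

Lemma cycle_is_blue (C : kgraph k T) :
  tight_cycle_of_colour red_blue Blue C -> forall e, e \in eset C -> ~~ is_red e.
Proof.
move=> [_ [_ /subsetP sub] col] e eC.
by have := col (exist _ e (sub e eC)) eC; rewrite /red_blue /=; case: is_red.
Qed.

Lemma degenerate_card (C : kgraph k T) :
  degenerate_tight_cycle C -> #|vset C| <= k.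
Proof. by case=> -[]; lia. Qed.

Lemma red_blue_no_partition m :
  k < m -> #|T| = k * m.+1 + 1 -> #|A| = m + 2 ->
  ~ red_blue_cycle_partition red_blue.
Proof.
move=> lt_km cardT cardA [R [B [colR colB cover disj]]].
have cardV : #|vset R| + #|vset B| = k * m.+1 + 1.
  by rewrite -cardT -cardsT -[setT]cover cardsU disjoint_setI0 // cards0 subn0.
have cardAV : #|A :&: vset R| + #|A :&: vset B| = m + 2.
  rewrite -cardA -[in RHS](setIT A) -[setT]cover setIUr cardsU setIACA setIid.
  by rewrite (disjoint_setI0 disj) setI0 cards0 subn0.
have blueB := cycle_is_blue colB; have redR := cycle_is_red colR.
have [[cycB _ _] [cycR _ _]] := (colB, colR).
case: cycR => [propR|/degenerate_card leR].
- have [xNR cardR] := red_cycle_count propR redR.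
  have xB : x \in vset B.
    have : x \in vset R :|: vset B by rewrite cover inE.
    by rewrite inE (negbTE xNR).
  set s := #|A :&: vset R| in cardR cardAV.
  (* Here [s <= m.+1] because [k * s <= k * m.+1 + 1] and [k > 1]. *)
  have [t tE] : exists t, s + t = m.+1.
    by exists (m.+1 - s); rewrite subnKC //; nia.
  have cardB : #|vset B| = k * t + 1 by nia.
  have cardAB : #|A :&: vset B| = t.+1 by lia.
  have [t0|t_gt0] := posnP t.
    have /cards1P[y BE] : #|vset B| == 1 by rewrite cardB t0 muln0.
    move: xB cardAB; rewrite BE inE => /eqP <-.
    have /disjoint_setI0-> : [disjoint A & [set x]].
      by rewrite disjoint_sym disjoints1.
    by rewrite cards0.
  case: cycB => [propB|/degenerate_card leB]; last by nia.
  case: (blue_cycle_count propB blueB) => [AB0|].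
    by rewrite AB0 cards0 in cardAB.
  rewrite cardB cardAB addn1 /= mulKn; last by lia.
  move=> le_t; have t1 : t = 1 by lia.
  have := blue_cycle_succ_k propB blueB xB.
  by rewrite cardB cardAB t1 muln1 addn1 => /(_ erefl).
- have leAR : #|A :&: vset R| <= k.
    exact: leq_trans (subset_leq_card (subsetIr _ _)) leR.
  case: cycB => [propB|/degenerate_card leB]; last by nia.
  case: (blue_cycle_count propB blueB) => [AB0|].
    by move: cardAV; rewrite AB0 cards0; lia.
  have : m <= (#|vset B|).-1 %/ k by rewrite leq_divRL; nia.
  lia.
Qed.

End Colouring.

(** * Choice of [x] and [A] *)

Lemma exists_subset_card (T : finType) (D : {set T}) n :
  n <= #|D| -> exists2 A : {set T}, A \subset D & #|A| = n.
Proof.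
move=> le_n; exists [set y in take n (enum D)].
  by apply/subsetP=> y; rewrite inE => /mem_take; rewrite mem_enum.
rewrite cardsE; have /card_uniqP-> : uniq (take n (enum D)).
  by rewrite take_uniq ?enum_uniq.
by rewrite size_takel // -cardE.
Qed.

Theorem proposition1p1 (k m : nat) (hk : 3 <= k) (hm : k + 1 <= m) :
  exists c : edge_colouring (complete_kgraph k 'I_(k * (m + 1) + 1)),
    ~ red_blue_cycle_partition c.
Proof.
have N_gt0 : 0 < k * (m + 1) + 1 by rewrite addn1.
(* Vertex 0 is an arbitrary choice; the [k * (m + 1)] other vertices leave room for [A]. *)
pose x := Ordinal N_gt0.
have [|A sAx cardA] := @exists_subset_card _ [set~ x] (m + 2).
  by rewrite cardsC1 card_ord; nia.
have xNA : x \notin A by apply/negP=> /(subsetP sAx); rewrite !inE eqxx.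
exists (red_blue (k := k) x A); apply: (red_blue_no_partition hk xNA (m := m)) => //.
  by rewrite -addn1.
by rewrite card_ord [m + 1]addn1.
Qed.
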